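(* Let $m\ge 3$, let $d\le e$ be coprime positive integers, and let $(d_s,e_s)$ be a starting vector for $(d,e)$. Let $k\in\mathbb{N}$, $l\ge 1$. Let $T^0\in\mathcal{T}^m_{d_s+kd,\,e_s+ke}$ and $(T^1,j_1)\in\mathcal{S}^m_{ld,\,le+1}$. Let $j_0$ be a sink of $T^0$ such that $R_{j_0}+R_{j_1}\le m$. Let $Q_{j_0,j_1}(T^0,T^1)$ be the glueing quiver with glueing vertex $j_2$ of dimension $\dim(j_2):=\dim(j_0)+\dim(j_1)-1$ (all other vertices keeping their dimensions). Then $Q_{j_0,j_1}(T^0,T^1)\in\mathcal{T}^m_{d_s+(k+l)d,\,e_s+(k+l)e}$.
   Context: Representations are finite-dimensional over $\mathbb{C}$; $\mathbb{N}$ includes $0$. Bipartite quivers: a quiver is bipartite if its vertex set is $I\sqcup J$ with every arrow going from a vertex of $I$ (sources) to a vertex of $J$ (sinks). Here quivers always come with a dimension vector; $\dim(q)$ is its value at the vertex $q$. The dimension type is $(\sum_{i\in I}\dim(i),\sum_{j\in J}\dim(j))$. For a vertex $q$, $R_q$ is the number of vertices of nonzero dimension adjacent to $q$. The quiver is $m$-bipartite if $R_q\le m$ for all vertices $q$. Stability: the slope of a representation $X$ is $\mu(X)=\sum_{i\in I}\dim X_i/\sum_{q\in I\sqcup J}\dim X_q$. $X$ is semistable (stable) if $\mu(U)\le\mu(X)$ (resp. $<$) for all nonzero (resp. all proper nonzero) subrepresentations $U$. A quiver with dimension vector is called (semi)stable if it has at least one (semi)stable representation of that dimension vector. $\mathcal{T}^m_{a,b}$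 is the set of all stable $m$-bipartite quivers of dimension type $(a,b)$. For a representation $X$, a subspace means $U=\bigoplus_{i\in I}U_i$ with $U_i\subseteq X_i$; it is $d'$-dimensional if $\sum_i\dim U_i=d'$, and $d_U:=\sum_{j\in J}\dim\big(\sum_{\alpha:i\to j}X_\alpha(U_i)\big)$ denotes the dimension of its image. Starting vector: $(d_s,e_s)\in\mathbb{N}^2$ with $d_s\le d$, $e_s\le e$, $e_sd-ed_s=1$, satisfying the glueing condition: $\frac{e+e_s}{d+d_s}d<e+1$; $\frac{e+e_s}{d+d_s}d>e$; $\frac{e_s-1}{d_s}\le\frac{e}{d}$ if $d\ne1$ and $(e_s-1)d=ed_s$ if $d=1$; $\frac{e+e_s}{d+d_s}d'<\lceil\frac{e}{d}d'\rceil$ for all $1\le d'<d$; $\gcd(d+d_s,e+e_s)=1$. With $d,e,d_s,e_s,k,l,m$ fixed, $\mathcal{S}^m_{ld,le+1}$ is the set of pairs $(T,j)$ where $T$ is an $m$-bipartite quiver of dimension type $(ld,le+1)$ and $j$ a sink of $T$ such that: (i) there is at most one arrow between any two vertices; (ii) after decreasing the dimension of $j$ by one, the resulting quiver is connected and semistable; (iii) there is a representation of $T$ such that every $d'$-dimensional subspace $U\neq 0$ satisfies $d_U>\frac{(k+l)e+e_s}{(k+l)d+d_s}d'$. Glueing quiver: for bipartite quivers $Q$ (on $I\sqcup J$) and $Q'$ (on $I'\sqcup J'$) with sinks $j\in J$, $j'\in J'$, $Q_{j,j'}(Q,Q')$ is the bipartite quiver obtained from the disjoint union of $Q$ and $Q'$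 by identifying $j$ and $j'$ to one sink $j''$, called the glueing vertex, keeping all arrows.
   Formalization: The sink j_0 is assumed to have nonzero dimension (if dim(j_0)=0, the decreased T^1 is a destabilizing subrepresentation and the claim fails); connectedness in (ii) is read on the vertices of nonzero dimension. *)

(* Defs.v *)
From mathcomp Require Import all_boot all_order all_algebra.
Set Implicit Arguments.
Unset Strict Implicit.
Unset Printing Implicit Defensive.
Import Order.TTheory GRing.Theory Num.Theory.
Local Open Scope ring_scope.

(* A finite bipartite quiver with sources [src] and sinks [snk], together with
   a dimension vector; the arrows i -> j are indexed by ['I_(narr i j)].      *)
Record bquiver := BQuiver {
  src : finType;
  snk : finType;
  narr : src -> snk -> nat;
  qdim : (src + snk)%type -> nat }.

Definition vertex (Q : bquiver) : finType := (src Q + snk Q)%type.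

Definition dim_type (Q : bquiver) : nat * nat :=
  ((\sum_(i : src Q) qdim (inl i))%N, (\sum_(j : snk Q) qdim (inr j))%N).

Definition adjacent (Q : bquiver) (p q : vertex Q) : bool :=
  match p, q with
  | inl i, inr j => (0 < narr i j)%N
  | inr j, inl i => (0 < narr i j)%N
  | _, _ => false
  end.

(* The number R_q. *)
Definition nb_adj (Q : bquiver) (q : vertex Q) : nat :=
  #|[set p : vertex Q | adjacent q p & (0 < qdim p)%N]|.

Definition mbipartite (m : nat) (Q : bquiver) : Prop :=
  forall q : vertex Q, (nb_adj q <= m)%N.

(* As in [nb_adj], vertices of dimension 0 are regarded as absent: it is the
   full subquiver on the vertices of nonzero dimension that is connected.     *)
Definition qconnected (Q : bquiver) : Prop :=
  forall p q : vertex Q, (0 < qdim p)%N -> (0 < qdim q)%N ->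
  connect [rel u v : vertex Q |
            [&& adjacent u v, (0 < qdim u)%N & (0 < qdim v)%N]] p q.

(* The linear map of an arrow acts on row vectors, on the right. *)
Definition rep (F : fieldType) (Q : bquiver) : Type :=
  forall (i : src Q) (j : snk Q),
    'I_(narr i j) -> 'M[F]_(qdim (inl i), qdim (inr j)).

(* Subspaces are given as row spaces of square matrices. *)
Definition subspaces (F : fieldType) (Q : bquiver) : Type :=
  forall q : vertex Q, 'M[F]_(qdim q).

Definition subrep (F : fieldType) (Q : bquiver) (X : rep F Q)
    (U : subspaces F Q) : Prop :=
  forall (i : src Q) (j : snk Q) (a : 'I_(narr i j)),
    (U (inl i) *m X i j a <= U (inr j))%MS.

Definition slope (Q : bquiver) (f : vertex Q -> nat) : rat :=
  (\sum_(i : src Q) f (inl i))%N%:R / (\sum_(q : vertex Q) f q)%N%:R.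

Definition semistable_rep (F : fieldType) (Q : bquiver) (X : rep F Q) : Prop :=
  forall U : subspaces F Q, subrep X U ->
    (exists q, U q != 0) ->
    slope (fun q => \rank (U q)) <= slope (@qdim Q).

Definition stable_rep (F : fieldType) (Q : bquiver) (X : rep F Q) : Prop :=
  forall U : subspaces F Q, subrep X U ->
    (exists q, U q != 0) -> (exists q, ~~ row_full (U q)) ->
    slope (fun q => \rank (U q)) < slope (@qdim Q).

Definition semistable (F : fieldType) (Q : bquiver) : Prop :=
  exists X : rep F Q, semistable_rep X.

Definition stable (F : fieldType) (Q : bquiver) : Prop :=
  exists X : rep F Q, stable_rep X.

(* The class T^m_{a,b}. *)
Definition in_T (F : fieldType) (m a b : nat) (Q : bquiver) : Prop :=
  [/\ mbipartite m Q, dim_type Q = (a, b) & stable F Q].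

Definition src_subspaces (F : fieldType) (Q : bquiver) : Type :=
  forall i : src Q, 'M[F]_(qdim (inl i)).

Definition src_dim (F : fieldType) (Q : bquiver) (U : src_subspaces F Q) : nat :=
  (\sum_(i : src Q) \rank (U i))%N.

(* The number d_U. *)
Definition image_dim (F : fieldType) (Q : bquiver) (X : rep F Q)
    (U : src_subspaces F Q) : nat :=
  (\sum_(j : snk Q)
     \rank (\sum_(i : src Q) \sum_(a < narr i j) <<U i *m X i j a>>)%MS)%N.

Definition glueing_condition (d e ds es : nat) : Prop :=
  let r : rat := (e + es)%N%:R / (d + ds)%N%:R in
  [/\ r * d%:R < e%:R + 1,
      r * d%:R > e%:R,
      (if d == 1%N then (es%:R - 1) * d%:R = e%:R * ds%:R :> rat
       else (es%:R - 1) / ds%:R <= e%:R / d%:R :> rat),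
      (forall d' : nat, (1 <= d')%N -> (d' < d)%N ->
         r * d'%:R < (Num.ceil (e%:R / d%:R * d'%:R : rat))%:~R)
    & coprime (d + ds) (e + es)].

Definition starting_vector (d e ds es : nat) : Prop :=
  [/\ (ds <= d)%N, (es <= e)%N,
      es%:Z * d%:Z - e%:Z * ds%:Z = 1
    & glueing_condition d e ds es].

Definition decrease_sink (Q : bquiver) (j : snk Q) : bquiver :=
  @BQuiver (src Q) (snk Q) (@narr Q)
    (fun q => if q == inr j then (qdim q).-1 else qdim q).

(* The class S^m_{ld,le+1}, which depends on all of the parameters below. *)
Record in_S (F : fieldType) (m d e ds es k l : nat)
    (Q : bquiver) (j : snk Q) : Prop := InS {
  S_mbipartite : mbipartite m Q;
  S_dim_type : dim_type Q = ((l * d)%N, (l * e + 1)%N);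
  (* needed for the dimension of j to be decreased by one *)
  S_sink_gt0 : (0 < qdim (inr j : vertex Q))%N;
  S_simple : forall (i : src Q) (j' : snk Q), (narr i j' <= 1)%N;
  S_connected : qconnected (decrease_sink j);
  S_semistable : semistable F (decrease_sink j);
  S_image : exists X : rep F Q, forall U : src_subspaces F Q,
    (exists i, U i != 0) ->
    (image_dim X U)%:R >
      ((k + l) * e + es)%N%:R / ((k + l) * d + ds)%N%:R * (src_dim U)%:R :> rat
}.

(* The glueing quiver of Q and Q' at j and j', with dimension n at the glueing
   vertex. The sinks are those of the disjoint union with j' removed, its
   arrows being redirected to j; so the glueing vertex is [inl j].            *)
Definition glue (Q Q' : bquiver) (j : snk Q) (j' : snk Q') (n : nat) : bquiver :=
  @BQuiver (src Q + src Q')%type (snk Q + {x : snk Q' | x != j'})%type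
    (fun p q => match p, q with
       | inl i, inl x => narr i x
       | inl _, inr _ => 0%N
       | inr i, inl x => if x == j then narr i j' else 0%N
       | inr i, inr y => narr i (val y)
       end)
    (fun q => match q with
       | inl (inl i) => qdim (inl i : vertex Q)
       | inl (inr i) => qdim (inl i : vertex Q')
       | inr (inl x) => if x == j then n else qdim (inr x : vertex Q)
       | inr (inr y) => qdim (inr (val y) : vertex Q')
       end).

(* Main.v *)
Require Import Defs.
From mathcomp Require Import all_boot all_order all_algebra.
From mathcomp Require Import closed_field mxpoly spectral.
From mathcomp Require Import boolp classical_sets filter topology normedtype.
From mathcomp Require Import sequences reals complex zify.
Set Implicit Arguments.
Unset Strict Implicit.
Unset Printing Implicit Defensive.
Import Order.TTheory GRing.Theory Num.Theory numFieldNormedType.Exports.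
Local Open Scope ring_scope.

(* Glue a stable representation X0 of T0 and a representation X1 of T1 along a
   line of the two vector spaces at the glueing vertex. This gives an extension
   0 -> X0 -> X -> X1' -> 0, where X1' is X1 modulo that line. Write (D, E) for
   the dimension type of X, so that E d = e D + 1, and let U be a subspace of X
   with source dimensions d0, d1 in T0, T1 and sink dimension e' = e0 + e1,
   where e0 is the part of U in X0 and e1 that of its image in X1'. If d0 > 0,
   stability of X0 gives d e0 > e d0 and semistability of X1' gives
   d e1 >= e d1, hence d e' >= e (d0 + d1) + 1, which is more than
   d (E / D) (d0 + d1) unless U = X. If d0 = 0, condition (iii) applies to X1.

   This needs a single X1 that has property (iii) and whose quotient X1' is
   semistable, so both properties must be generic. Along an affine line of
   representations the set of parameters t for which there is a
   subrepresentation of a given dimension vector is first-order definable,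
   hence finite or cofinite by quantifier elimination. If it is cofinite, it
   contains every point of the line: a limit of orthogonal projectors onto
   such subrepresentations at nearby points is again such a projector. *)

(** * Solvability of polynomial systems for generic parameters *)

Section Definable.
Variable F : closedFieldType.

Lemma rterm_poly (u : GRing.term F) : GRing.rterm u ->
  exists p : {poly F}, forall t, GRing.eval [:: t] u = p.[t].
Proof.
elim: u => //=.
(* In the environment [[:: t]], variable 0 is t and every other variable reads the default 0. *)
- by move=> [|k] _; [exists 'X => t; rewrite hornerX
                    |exists 0 => t; rewrite horner0 /= nth_nil].
- by move=> x _; exists x%:P => t; rewrite hornerC.
- by move=> n _; exists n%:R => t; rewrite -polyC_natr hornerC.
- move=> u IHu v IHv /andP[/IHu[p pE] /IHv[q qE]].
  by exists (p + q) => t; rewrite hornerD pE qE.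
- by move=> u IHu /IHu[p pE]; exists (- p) => t; rewrite hornerN pE.
- by move=> u IHu n /IHu[p pE]; exists (p *+ n) => t; rewrite hornerMn pE.
- move=> u IHu v IHv /andP[/IHu[p pE] /IHv[q qE]].
  by exists (p * q) => t; rewrite hornerM pE qE.
- by move=> u IHu n /IHu[p pE]; exists (p ^+ n) => t; rewrite horner_exp pE.
Qed.

(** An atom equates two polynomials in t: it is always true if they coincide, and false off the
    roots of their difference otherwise. A Boolean combination is then constant off the roots of the
    product of the exceptional polynomials. *)
Lemma qf_eval_generic (f : GRing.formula F) :
  GRing.qf_form f -> GRing.rformula f ->
  exists2 h : {poly F}, h != 0 &
  exists b, forall t, h.[t] != 0 -> GRing.qf_eval [:: t] f = b.
Proof.
have both g1 g2 (op : bool -> bool -> bool) :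
  (exists2 h : {poly F}, h != 0 &
   exists b, forall t, h.[t] != 0 -> GRing.qf_eval [:: t] g1 = b) ->
  (exists2 h : {poly F}, h != 0 &
   exists b, forall t, h.[t] != 0 -> GRing.qf_eval [:: t] g2 = b) ->
  exists2 h : {poly F}, h != 0 & exists b, forall t, h.[t] != 0 ->
    op (GRing.qf_eval [:: t] g1) (GRing.qf_eval [:: t] g2) = b.
  move=> [h1 h1n0 [b1 b1P]] [h2 h2n0 [b2 b2P]].
  exists (h1 * h2); first by rewrite mulf_neq0.
  exists (op b1 b2) => t; rewrite hornerM mulf_eq0 => /norP[t1 t2].
  by rewrite b1P ?b2P.
elim: f => //=.
- by move=> b _ _; exists 1; [exact: oner_neq0|exists b].
- move=> u v _ /andP[/rterm_poly[p pE] /rterm_poly[q qE]].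
  have [pq|pq] := eqVneq p q.
    exists 1; first exact: oner_neq0.
    by exists true => t _; rewrite pE qE pq eqxx.
  exists (p - q); first by rewrite subr_eq0.
  exists false => t; rewrite hornerD hornerN pE qE subr_eq0.
  by move/negbTE.
- move=> f1 IH1 f2 IH2 /andP[q1 q2] /andP[r1 r2].
  by apply: (both _ _ andb); auto.
- move=> f1 IH1 f2 IH2 /andP[q1 q2] /andP[r1 r2].
  by apply: (both _ _ orb); auto.
- move=> f1 IH1 f2 IH2 /andP[q1 q2] /andP[r1 r2].
  by apply: (both _ _ implb); auto.
- move=> f1 IH1 q1 r1; have [h hn0 [b bP]] := IH1 q1 r1.
  by exists h => //; exists (~~ b) => t /bP ->.
Qed.

(** Quantifier elimination over the algebraically closed field reduces this to [qf_eval_generic]. *)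
Lemma holds_generic (f : GRing.formula F) : GRing.rformula f ->
  exists2 h : {poly F}, h != 0 &
  (forall t, h.[t] != 0 -> GRing.holds [:: t] f) \/
  (forall t, h.[t] != 0 -> ~ GRing.holds [:: t] f).
Proof.
move=> rf.
have closedF : GRing.closed_field_axiom F := @solve_monicpoly F.
pose wf := @ClosedFieldQE.wf_ex_elim F.
pose ok := ClosedFieldQE.holds_ex_elim closedF.
have /andP[qf rqf] := GRing.quantifier_elim_wf wf rf.
have [h hn0 [b bP]] := qf_eval_generic qf rqf.
exists h => //; case: b bP => bP; [left|right] => t /bP ht.
  exact/(GRing.quantifier_elim_rformP wf ok).
by move/(GRing.quantifier_elim_rformP wf ok [:: t] rf); rewrite ht.
Qed.

Definition sol (sys : seq (GRing.term F)) (e : seq F) :=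
  all (fun u => GRing.eval e u == 0) sys.

Lemma sol_generic (N : nat) (sys : seq (GRing.term F)) :
  all (@GRing.rterm F) sys ->
  exists2 h : {poly F}, h != 0 &
  (forall t, h.[t] != 0 -> exists2 e, e`_0 = t & sol sys e) \/
  (forall t, h.[t] != 0 ->
     forall e, size e = N.+1 -> e`_0 = t -> ~~ sol sys e).
Proof.
move=> rsys.
pose f := foldr (fun u => GRing.And (GRing.Equal u 0)) (GRing.Bool true) sys.
have rf : GRing.rformula f.
  by rewrite /f; elim: sys rsys {f} => //= u s IHs /andP[-> /IHs ->].
have fP e : GRing.holds e f <-> sol sys e.
  rewrite /f; elim: sys {rsys f rf} => //= u s IHs.
  split=> [[/eqP -> /IHs ->] //|/andP[/eqP ? /IHs ?]].
  by split.
(* The variables 1 to N are bound; the parameter, variable 0, stays free. *)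
pose g := foldr GRing.Exists f (iota 1 N).
have rg : GRing.rformula g by rewrite /g; elim: (iota 1 N).
have [h hn0 hP] := holds_generic rg; exists h => //.
case: hP => hP; [left|right] => t /hP.
  move/GRing.foldExistsP => [e ee /fP se]; exists e => //.
  by rewrite -(ee 0%N) // inE mem_iota.
move=> ng e sz e0; apply/negP => se; apply: ng; apply/GRing.foldExistsP.
exists e; last exact/fP.
(* Off the indices 1 to N, [e] must agree with [[:: t]]; past N both read the default 0. *)
move=> [|i]; first by rewrite e0.
rewrite !inE mem_iota add1n ltnS /= -ltnNge => Ni.
by rewrite nth_nil nth_default // sz.
Qed.

End Definable.

(** * Limits of bounded solutions *)

Local Open Scope complex_scope.

Section Limits.
Variables (R : realType) (U : set_system nat).
Hypothesis ultraU : UltraFilter U.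

(** Compactness of [-b, b] gives a cluster point, to which an ultrafilter must converge. One
    ultrafilter then serves all coordinates at once, with no successive extraction of
    subsequences. *)
Lemma ultra_bounded_cvg (x : nat -> R) (b : R) :
  (forall n, `|x n| <= b) -> exists l : R, (x @ U --> l)%classic.
Proof.
move=> xb; have PU : ProperFilter U := @ultra_proper _ _ ultraU.
have FU : ProperFilter (x @ U)%classic by exact: fmap_proper_filter.
have := @segment_compact R (- b) b (x @ U)%classic FU.
case.
  apply: (@filterE _ U) => n; rewrite /= in_itv /= -ler_norml; exact: xb.
move=> l [_ clU]; exists l => V Vl.
have [//|nV] := @in_ultra_setVsetC _ U (x @^-1` V)%classic ultraU.
by have [y [nVy /nVy]] := clU (~` V)%classic V nV Vl.
Qed.

Definition clim (z : nat -> R[i]) (l : R[i]) : Prop :=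
  ((fun n => complex.Re (z n)) @ U --> complex.Re l)%classic /\
  ((fun n => complex.Im (z n)) @ U --> complex.Im l)%classic.

Lemma clim_cst c : clim (fun=> c) c.
Proof. by split; exact: cvg_cst. Qed.

Lemma climD z z' l l' : clim z l -> clim z' l' ->
  clim (fun n => z n + z' n) (l + l').
Proof.
have ReD (a b : R[i]) : complex.Re (a + b) = complex.Re a + complex.Re b.
  by case: a b => ? ? [].
have ImD (a b : R[i]) : complex.Im (a + b) = complex.Im a + complex.Im b.
  by case: a b => ? ? [].
move=> [zr zi] [zr' zi']; split.
- by rewrite ReD; under eq_fun do rewrite ReD; exact: cvgD.
- by rewrite ImD; under eq_fun do rewrite ImD; exact: cvgD.
Qed.

Lemma climM z z' l l' : clim z l -> clim z' l' ->
  clim (fun n => z n * z' n) (l * l').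
Proof.
have ReM (a b : R[i]) : complex.Re (a * b) =
    complex.Re a * complex.Re b - complex.Im a * complex.Im b.
  by case: a b => ? ? [].
have ImM (a b : R[i]) : complex.Im (a * b) =
    complex.Re a * complex.Im b + complex.Im a * complex.Re b.
  by case: a b => ? ? [].
move=> [zr zi] [zr' zi']; split.
- rewrite ReM; under eq_fun do rewrite ReM.
  by apply: cvgB; apply: cvgM.
- rewrite ImM; under eq_fun do rewrite ImM.
  by apply: cvgD; apply: cvgM.
Qed.

Lemma climN z l : clim z l -> clim (fun n => - z n) (- l).
Proof.
move=> /(climM (clim_cst (-1))); rewrite mulN1r.
by under eq_fun do rewrite mulN1r.
Qed.

Lemma climMn z l k : clim z l -> clim (fun n => z n *+ k) (l *+ k).
Proof.
move=> /(climM (clim_cst k%:R)); rewrite mulr_natl.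
by under eq_fun do rewrite mulr_natl.
Qed.

Lemma climX z l k : clim z l -> clim (fun n => z n ^+ k) (l ^+ k).
Proof.
move=> zl; elim: k => [|k IHk]; first exact: clim_cst.
by rewrite exprS; under eq_fun do rewrite exprS; exact: climM.
Qed.

Lemma clim_unique z l l' : clim z l -> clim z l' -> l = l'.
Proof.
move=> [zr zi] [zr' zi'].
have PU : ProperFilter U := @ultra_proper _ _ ultraU.
have := cvg_unique (@norm_hausdorff _ _) zr zr'.
have := cvg_unique (@norm_hausdorff _ _) zi zi'.
by case: l l' {zr zi zr' zi'} => ? ? [? ?] /= -> ->.
Qed.

Lemma clim_bounded (z : nat -> R[i]) :
  (forall n, `|z n| <= 1) -> exists l, clim z l.
Proof.
move=> zb.
have [x xl] : exists l : R, ((fun n => complex.Re (z n)) @ U --> l)%classic.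
  apply: (@ultra_bounded_cvg _ 1) => n; rewrite -lecR.
  exact: le_trans (normc_ge_Re _) (zb n).
have [y yl] : exists l : R, ((fun n => complex.Im (z n)) @ U --> l)%classic.
  apply: (@ultra_bounded_cvg _ 1) => n; rewrite -lecR.
  (* The imaginary part of z is, up to sign, the real part of i z. *)
  apply: le_trans (zb n); have := normc_ge_Re (z n * 'i%C).
  rewrite ReiNIm normrN normrM.
  rewrite (_ : `|'i%C| = 1 :> R[i]) ?mulr1 //.
  by rewrite normc_def /= expr0n expr1n add0r sqrtr1.
by exists (x +i* y).
Qed.

Lemma clim_eval (e : nat -> seq R[i]) (e0 : seq R[i]) (u : GRing.term R[i]) :
  (forall i, clim (fun n => (e n)`_i) e0`_i) -> GRing.rterm u ->
  clim (fun n => GRing.eval (e n) u) (GRing.eval e0 u).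
Proof.
move=> ee; elim: u => //=.
- by move=> x _; exact: clim_cst.
- by move=> k _; exact: clim_cst.
- by move=> u IHu v IHv /andP[/IHu ? /IHv ?]; exact: climD.
- by move=> u IHu /IHu; exact: climN.
- by move=> u IHu k /IHu; exact: climMn.
- by move=> u IHu v IHv /andP[/IHu ? /IHv ?]; exact: climM.
- by move=> u IHu k /IHu; exact: climX.
Qed.

End Limits.

(** Take t_n tending to 0 off the roots of h. Bounded solutions at t_n have a limit along an
    ultrafilter, coordinate by coordinate, and polynomial equations persist in the limit. *)
Lemma sol_limit (R : realType) (N : nat) (sys : seq (GRing.term R[i]))
    (h : {poly R[i]}) :
  all (@GRing.rterm R[i]) sys -> h != 0 ->
  (forall t, h.[t] != 0 -> exists e, [/\ size e = N.+1, e`_0 = t, sol sys e &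
     forall i, (0 < i)%N -> `|e`_i| <= 1]) ->
  exists e, [/\ size e = N.+1, e`_0 = 0 & sol sys e].
Proof.
move=> rsys hn0 hP.
have tP n : exists t : R, [/\ 0 <= t, t <= n.+1%:R^-1 & h.[t%:C] != 0].
  (* These [size h] distinct points outnumber the roots of h. *)
  pose s := [seq ((n.+1 + k)%:R^-1 : R)%:C | k <- iota 0 (size h)].
  have us : uniq s.
    rewrite map_inj_uniq ?iota_uniq // => k k' /complexI /invr_inj /eqP.
    by rewrite eqr_nat eqn_add2l => /eqP.
  have : ~~ all (root h) s.
    apply/negP => /(max_poly_roots hn0) /(_ us).
    by rewrite size_map size_iota ltnn.
  case/allPn => _ /mapP[k _ ->] hk.
  exists (n.+1 + k)%:R^-1; split => //; first by rewrite invr_ge0.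
  by rewrite lef_pV2 ?posrE ?ltr0n // ler_nat leq_addr.
have [t tP'] := choice tP.
have /choice[e eP] : forall n, exists e, [/\ size e = N.+1, e`_0 = (t n)%:C,
    sol sys e & forall i, (0 < i)%N -> `|e`_i| <= 1].
  by move=> n; have [_ _ /hP] := tP' n.
have [U [ultraU infU]] := @ultraFilterLemma nat _ (eventually_filter).
have t0 : clim U (fun n => (e n)`_0) 0.
  have -> : (fun n => (e n)`_0) = (fun n => (t n)%:C).
    by apply/funext => n; have [_ ->] := eP n.
  split => /=; last exact: cvg_cst.
  apply: (@cvg_trans _ (t @ \oo)%classic); first exact: cvg_app infU.
  apply: (@squeeze_cvgr _ _ _ _ (fun=> 0) (fun n => n.+1%:R^-1)).
  - by apply: filterE => n; have [-> ->] := tP' n.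
  - exact: cvg_cst.
  - exact: cvg_harmonic.
have ce i : exists l, clim U (fun n => (e n)`_i) l.
  case: i => [|i]; first by exists 0.
  by apply: clim_bounded => n; have [_ _ _ ->] := eP n.
have [l lP] := choice ce.
pose e0 := mkseq l N.+1.
have ee i : clim U (fun n => (e n)`_i) e0`_i.
  have [iN|iN] := ltnP i N.+1; first by rewrite nth_mkseq.
  rewrite nth_default ?size_mkseq //.
  have -> : (fun n => (e n)`_i) = fun=> 0.
    by apply/funext => n; rewrite nth_default //; have [->] := eP n.
  exact: clim_cst.
exists e0; rewrite size_mkseq; split => //.
  exact: (clim_unique ultraU (ee 0%N) t0).
have solP n : sol sys (e n) by have [] := eP n.
elim: {hP eP} sys rsys solP => // u s IHs /= /andP[ru rs] solP.
apply/andP; split; last by apply: IHs => // n; have /andP[] := solP n.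
apply/eqP; apply: (clim_unique ultraU (clim_eval ultraU ee ru)).
have -> : (fun n => GRing.eval (e n) u) = fun=> 0.
  by apply/funext => n; have /andP[/eqP] := solP n.
exact: clim_cst.
Qed.

(** * Subrepresentations along a line of representations *)

Local Close Scope complex_scope.

(** A full-rank factorization P = A B of an idempotent has B A = 1, so tr P = tr (B A) is the rank.
    The rank condition on a projector thus becomes a linear equation in its entries. *)
Lemma mxtrace_idempotent (F : fieldType) n (P : 'M[F]_n) :
  P *m P = P -> \tr P = (\rank P)%:R.
Proof.
move=> PP; move: (mulmx_base P) (col_base_full P) (row_base_free P).
move: (col_base P) (row_base P) => A B AB fA fB.
have BA : B *m A = 1%:M.
  apply: (row_full_inj fA); apply: (row_free_inj fB) => /=.
  by rewrite mulmx1 !mulmxA AB -mulmxA AB PP.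
by rewrite -[in LHS]AB mxtrace_mulC BA mxtrace1.
Qed.

(** If the rows of B form an orthonormal basis of U, then P = B^* B is Hermitian and idempotent, so
    P_kk is the sum over l of |P_kl|^2. Hence P_kk^2 <= P_kk, which gives P_kk <= 1, and then
    |P_kl|^2 <= P_kk bounds every entry. *)
Lemma ortho_projector (C : numClosedFieldType) n (U : 'M[C]_n) :
  exists P : 'M[C]_n, [/\ P *m P = P, (P :=: U)%MS &
    forall k l, `|P k l| <= 1].
Proof.
pose B := schmidt (row_base U).
have uB : B \is unitarymx by rewrite schmidt_unitarymx // rank_leq_col.
pose P := map_mx Num.conj B^T *m B.
have BB : B *m map_mx Num.conj B^T = 1%:M by apply/unitarymxP.
have PP : P *m P = P by rewrite /P mulmxA -(mulmxA _ B) BB mulmx1.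
have PC : map_mx Num.conj P^T = P.
  rewrite /P trmx_mul map_mxM /= -map_trmx trmxK; congr (_ *m _).
  by apply/matrixP => k l; rewrite !mxE conjCK.
have Pkk k : P k k = \sum_l `|P k l| ^+ 2.
  rewrite -[in LHS]PP mxE; apply: eq_bigr => l _.
  by rewrite normCK -[in X in _ * X]PC !mxE.
have le_sq k l : `|P k l| ^+ 2 <= P k k.
  rewrite (Pkk k) (bigD1 l) //= lerDl.
  by apply: sumr_ge0 => ? _; rewrite exprn_ge0.
have P0 k : 0 <= P k k by rewrite Pkk sumr_ge0 // => ? _; rewrite exprn_ge0.
have P1 k : P k k <= 1.
  have := le_sq k k; rewrite ger0_norm // expr2 => h.
  have [->|Pn0] := eqVneq (P k k) 0; first exact: ler01.
  by rewrite -(ler_pM2r (x := P k k)) ?mul1r // lt_def Pn0 P0.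
exists P; split => //; last first.
  move=> k l; rewrite -(@expr_le1 _ 2) //.
  exact: le_trans (le_sq k l) (P1 k).
have eB : (B :=: U)%MS.
  exact: eqmx_trans (eqmx_schmidt_free (row_base_free U)) (eq_row_base U).
apply: eqmx_trans eB; apply/eqmxP/andP; split; first exact: submxMl.
by apply/submxP; exists B; rewrite /P mulmxA BB mul1mx.
Qed.

Section Reps.
Variables (F : numFieldType) (Q : bquiver).

Definition has_subrep (X : rep F Q) (r : vertex Q -> nat) : Prop :=
  exists2 U : subspaces F Q, subrep X U & forall q, \rank (U q) = r q.

(* Subrepresentations are encoded by idempotents projecting onto them: their
   existence becomes the solvability of polynomial equations, and orthogonal
   projectors provide bounded solutions. *)
Definition projector_family (X : rep F Q) (r : vertex Q -> nat)
    (P : subspaces F Q) : Prop :=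
  [/\ forall q, P q *m P q = P q, forall q, \tr (P q) = (r q)%:R &
      forall i j (a : 'I_(narr i j)),
        P (inl i) *m X i j a *m P (inr j) = P (inl i) *m X i j a].

Definition add_rep (X Z : rep F Q) (t : F) : rep F Q :=
  fun i j a => X i j a + t *: Z i j a.

Lemma has_subrep_projector (X : rep F Q) r P :
  projector_family X r P -> has_subrep X r.
Proof.
move=> [PP trP XP]; exists P => [i j a|q].
  by rewrite -XP submxMl.
by apply/eqP; rewrite -(eqr_nat F) -(mxtrace_idempotent (PP q)) trP.
Qed.
End Reps.

Lemma projector_has_subrep (F : numClosedFieldType) (Q : bquiver)
    (X : rep F Q) (r : vertex Q -> nat) :
  has_subrep X r -> exists2 P, projector_family X r P &
    forall q k l, `|P q k l| <= 1.
Proof.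
move=> [U XU rU].
have /fin_all_exists[P PE] : forall q, exists P : 'M[F]_(qdim q),
  [/\ P *m P = P, (P :=: U q)%MS & forall k l, `|P k l| <= 1].
  by move=> q; exact: ortho_projector.
exists P; last by move=> q; case: (PE q).
split=> [q|q|i j a].
- by case: (PE q).
- by case: (PE q) => PP PU _; rewrite mxtrace_idempotent // PU rU.
have [_ PUi _] := PE (inl i); have [PPj PUj _] := PE (inr j).
have : (P (inl i) *m X i j a <= P (inr j))%MS.
  by rewrite PUj (submx_trans _ (XU i j a)) // submxMr // PUi.
by case/submxP => D ->; rewrite -mulmxA PPj.
Qed.

(** * The polynomial system for projectors along a line *)

Section System.
Variables (F : numClosedFieldType) (Q : bquiver) (X Z : rep F Q).
Variable r : vertex Q -> nat.
Import MatrixFormula.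
Notation term := (GRing.term F).

Lemma all_flatten T (a : pred T) (ss : seq (seq T)) :
  all a (flatten ss) = all (all a) ss.
Proof. by elim: ss => //= s ss IHss; rewrite all_cat IHss. Qed.

Lemma all_codom T (I : finType) (a : pred T) (f : I -> T) :
  all a (codom f) = [forall x, a (f x)].
Proof.
rewrite all_map; apply/allP/forallP => af x; last by move=> _; exact: af.
by apply: af; rewrite mem_enum.
Qed.

Definition mxeq_sys m n (A B : 'M[term]_(m, n)) : seq term :=
  codom (fun kl : 'I_m * 'I_n => (A kl.1 kl.2 - B kl.1 kl.2)%T).

Lemma sol_mxeq e m n (A B : 'M[term]_(m, n)) :
  sol (mxeq_sys A B) e <-> eval_mx e A = eval_mx e B.
Proof.
rewrite /sol all_codom; split=> [/forallP AB|AB].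
  apply/matrixP => k l; rewrite !mxE; apply/eqP; rewrite -subr_eq0.
  exact: AB (k, l).
apply/forallP => -[k l] /=; rewrite subr_eq0.
by have /matrixP/(_ k l) := AB; rewrite !mxE => ->.
Qed.

Definition rmx m n (A : 'M[term]_(m, n)) := forall k l, GRing.rterm (A k l).

Lemma rterm_sum (I : finType) (f : I -> term) :
  (forall i, GRing.rterm (f i)) -> GRing.rterm (\big[GRing.Add/0%T]_i f i).
Proof.
move=> fr; rewrite (big_morph (@GRing.rterm F) (id1 := true) (op1 := andb)) //.
by rewrite big1 // => i _; exact: fr.
Qed.

Lemma rmx_mul m n p (A : 'M[term]_(m, n)) (B : 'M_(n, p)) :
  rmx A -> rmx B -> rmx (mulmx_term A B).
Proof.
by move=> rA rB k l; rewrite mxE; apply: rterm_sum => j /=; rewrite rA rB.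
Qed.

Lemma rterm_mxeq m n (A B : 'M[term]_(m, n)) :
  rmx A -> rmx B -> all (@GRing.rterm F) (mxeq_sys A B).
Proof.
by move=> rA rB; rewrite all_codom; apply/forallP => kl /=; rewrite rA rB.
Qed.

Definition proj_index : finType :=
  {q : vertex Q & ('I_(qdim q) * 'I_(qdim q))%type}.

(** Variable 0 is reserved for the line parameter, hence the successor. *)
Definition proj_var (q : vertex Q) : 'M[term]_(qdim q) :=
  \matrix_(k, l) ('X_(enum_rank (existT _ q (k, l) : proj_index)).+1)%T.

Definition proj_env (t : F) (P : subspaces F Q) : seq F :=
  t :: codom (fun x : proj_index => P (tag x) (tagged x).1 (tagged x).2).

Lemma size_proj_env t P : size (proj_env t P) = #|proj_index|.+1.
Proof. by rewrite /= size_codom. Qed.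

Lemma eval_proj_var t P q : eval_mx (proj_env t P) (proj_var q) = P q.
Proof.
by apply/matrixP => k l; rewrite !mxE /= nth_codom enum_rankK.
Qed.

Definition line_mx i j (a : 'I_(narr i j)) : 'M[term]_(_, _) :=
  \matrix_(k, l) (GRing.Const (X a k l) + 'X_0 * GRing.Const (Z a k l))%T.

Lemma eval_line_mx e i j (a : 'I_(narr i j)) :
  eval_mx e (line_mx a) = add_rep X Z e`_0 a.
Proof. by apply/matrixP => k l; rewrite !mxE. Qed.

Definition arrow_index : finType :=
  {ij : (src Q * snk Q)%type & 'I_(narr ij.1 ij.2)}.

Definition arrow_eqs (x : arrow_index) : seq term :=
  let PX := mulmx_term (proj_var (inl (tag x).1)) (line_mx (tagged x)) in
  mxeq_sys (mulmx_term PX (proj_var (inr (tag x).2))) PX.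

Definition proj_sys : seq term :=
  flatten (codom (fun q : vertex Q =>
    mxeq_sys (mulmx_term (proj_var q) (proj_var q)) (proj_var q)))
  ++ codom (fun q : vertex Q =>
       (\big[GRing.Add/0]_k proj_var q k k - (r q)%:R)%T)
  ++ flatten (codom arrow_eqs).

Lemma rterm_proj_sys : all (@GRing.rterm F) proj_sys.
Proof.
have rv q : rmx (proj_var q) by move=> k l; rewrite mxE.
have rl i j (a : 'I_(narr i j)) : rmx (line_mx a) by move=> k l; rewrite mxE.
rewrite !all_cat !all_flatten !all_codom.
apply/and3P; split; apply/forallP => x /=.
- by apply: rterm_mxeq => //; exact: rmx_mul.
- by rewrite andbT; apply: rterm_sum => k; exact: rv.
- by apply: rterm_mxeq; do ?apply: rmx_mul.
Qed.

Lemma sol_proj_sys e : sol proj_sys e <->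
  projector_family (add_rep X Z e`_0) r (fun q => eval_mx e (proj_var q)).
Proof.
rewrite /sol !all_cat !all_flatten !all_codom; split.
  case/and3P => /forallP PP /forallP trP /forallP XP; split.
  - move=> q; rewrite -eval_mulmx; apply/sol_mxeq.
    exact: PP.
  - move=> q; have := trP q; move=> /=.
    rewrite subr_eq0 => /eqP <-.
    rewrite (big_morph (GRing.eval e) (id1 := 0) (op1 := +%R)) //.
    by apply: eq_bigr => k _; rewrite !mxE.
  - move=> i j a; pose x : arrow_index := existT _ (i, j) a.
    have := XP x; move=> /sol_mxeq.
    by rewrite !eval_mulmx eval_line_mx.
move=> [PP trP XP]; apply/and3P; split; apply/forallP => x /=.
- by apply/sol_mxeq; rewrite eval_mulmx.
- rewrite subr_eq0 -trP; apply/eqP.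
  rewrite (big_morph (GRing.eval e) (id1 := 0) (op1 := +%R)) //.
  by apply: eq_bigr => k _; rewrite !mxE.
- by apply/sol_mxeq; rewrite !eval_mulmx eval_line_mx.
Qed.

End System.

(** If such subrepresentations existed for generic t, bounded projectors onto them would have a
    limit at t = 0, giving one of X. *)
Lemma no_subrep_generic (R : realType) (Q : bquiver) (X Z : rep R[i] Q)
    (r : vertex Q -> nat) :
  ~ has_subrep X r -> exists2 h : {poly R[i]}, h != 0 &
  forall t, h.[t] != 0 -> ~ has_subrep (add_rep X Z t) r.
Proof.
move=> nX; pose N := #|proj_index Q|.
have sol_env (t : R[i]) P : projector_family (add_rep X Z t) r P ->
    sol (proj_sys X Z r) (proj_env t P).
  move=> [PP trP XP]; apply/sol_proj_sys.
  by split=> *; rewrite !eval_proj_var.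
have [h hn0 hP] := sol_generic N (rterm_proj_sys X Z r).
exists h => // t ht; case: hP => hP; last first.
  move=> /projector_has_subrep[P /sol_env solP _].
  by have /negP := hP t ht _ (size_proj_env t P) erefl.
case: nX.
have rsys := rterm_proj_sys X Z r.
have [|e [_ e0 /sol_proj_sys sole]] := sol_limit (N := N) rsys hn0.
  move=> s /hP[e e0 /sol_proj_sys /has_subrep_projector].
  (* Passing to orthogonal projectors makes the solution at [s] bounded. *)
  move=> /projector_has_subrep[P]; rewrite e0 => /sol_env sP P1.
  exists (proj_env s P); split => //; first exact: size_proj_env.
  move=> [|i] // _ /=.
  have [iN|iN] := ltnP i N; last by rewrite nth_default ?normr0 // size_codom.
  by rewrite (nth_codom _ _ (Ordinal iN)).
have := has_subrep_projector sole; rewrite e0.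
case=> U XU rU; exists U => // i j a.
by have := XU i j a; rewrite /add_rep scale0r addr0.
Qed.

(** * Decreasing a sink *)

(** Only finitely many dimension vectors can occur; each one violating [P] is excluded off the roots
    of one polynomial, and the product of these works. *)
Lemma subrep_generic (R : realType) (Q : bquiver) (X Z : rep R[i] Q)
    (P : (vertex Q -> nat) -> Prop) :
  (forall U, subrep X U -> P (fun q => \rank (U q))) ->
  exists2 h : {poly R[i]}, h != 0 & forall t, h.[t] != 0 ->
    forall U, subrep (add_rep X Z t) U -> P (fun q => \rank (U q)).
Proof.
move=> XP; pose M := (\sum_(q : vertex Q) qdim q)%N.
have rM (U : subspaces R[i] Q) q : (\rank (U q) < M.+1)%N.
  rewrite ltnS (leq_trans (rank_leq_row _)) // /M (bigD1 q) //= leq_addr //.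
have hP (r : {ffun vertex Q -> 'I_M.+1}) : exists h : {poly R[i]}, h != 0 /\
    forall t, h.[t] != 0 -> has_subrep (add_rep X Z t) (fun q => r q) ->
    P (fun q => r q : nat).
  have [Pr|nPr] := pselect (P (fun q => r q : nat)).
    by exists 1; split => //; exact: oner_neq0.
  have [|h hn0 hP] := @no_subrep_generic R Q X Z (fun q => r q).
    move=> [U XU rU]; apply: nPr.
    have <- : (fun q => \rank (U q)) = (fun q => r q : nat) by exact/funext.
    exact: XP.
  by exists h; split => // t /hP.
have [h hE] := fin_all_exists hP.
exists (\prod_r h r) => [|t].
  by apply/prodf_neq0 => r _; case: (hE r).
rewrite horner_prod => /prodf_neq0 ht U XU.
pose r := [ffun q => Ordinal (rM U q)].
have [_ /(_ t (ht r isT))] := hE r.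
have -> : (fun q => r q : nat) = (fun q => \rank (U q)).
  by apply/funext => q; rewrite ffunE.
by apply; exists U.
Qed.

(** A truncated shift: the coordinate vector of index i goes to that of index i + s - s', or to 0 if
    this is out of range. Inclusions of coordinate subspaces and quotients by them all have this
    form. *)
Definition shift_mx {F : fieldType} (s s' p q : nat) : 'M[F]_(p, q) :=
  \matrix_(i, j) ((i + s)%N == (j + s')%N)%:R.

Section ShiftMx.
Variable F : fieldType.

(** Offsets add up as long as the first shift sends no coordinate vector to 0, which is what the
    hypothesis expresses. *)
Lemma shift_mx_mul s s' u u' p q n :
  (forall i : 'I_p, (s' <= i + s < q + s')%N) ->
  shift_mx s s' p q *m shift_mx u u' q n =
  shift_mx (s + u) (s' + u') p n :> 'M[F]_(p, n).
Proof.
move=> sP; apply/matrixP => i j; have /andP[s1 s2] := sP i.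
have kq : (i + s - s' < q)%N by lia.
rewrite !mxE (bigD1 (Ordinal kq)) //= big1 ?addr0 => [|k nk].
  rewrite !mxE /= subnK // eqxx mul1r; congr (_%:R); congr (nat_of_bool _).
  by apply/eqP/eqP; lia.
rewrite !mxE; case: eqP => [e|_]; last by rewrite mul0r.
by case/eqP: nk; apply/val_inj; rewrite /= e addnK.
Qed.

Lemma shift_mx_cancel k s s' p q :
  shift_mx (k + s) (k + s') p q = shift_mx s s' p q :> 'M[F]_(p, q).
Proof. by apply/matrixP => i j; rewrite !mxE !(addnCA _ k) eqn_add2l. Qed.

Lemma shift_mx_id s n : shift_mx s s n n = 1%:M :> 'M[F]_n.
Proof. by apply/matrixP => i j; rewrite !mxE eqn_add2r. Qed.

Lemma shift_mx_eq0 s s' p q : (p + s <= s')%N ->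
  shift_mx s s' p q = 0 :> 'M[F]_(p, q).
Proof.
move=> ps; apply/matrixP => i j; rewrite !mxE.
rewrite (_ : _ == _ = false) //; apply/negbTE; rewrite neq_ltn.
by rewrite (leq_trans _ (leq_trans ps (leq_addl _ _))) // ltn_add2r.
Qed.

Lemma shift_mx_free s p q : (p + s <= q)%N ->
  row_free (shift_mx s 0 p q : 'M[F]_(p, q)).
Proof.
move=> pq; apply/row_freeP; exists (shift_mx 0 s q p).
rewrite shift_mx_mul; first by rewrite addn0 shift_mx_id.
by move=> i; have := ltn_ord i; lia.
Qed.

End ShiftMx.

Section Decrease.
Variables (F : fieldType) (Q : bquiver) (j : snk Q).

(** At [j] this is the quotient by the line of the first coordinate vector, elsewhere the identity;
    [lift_mx] is a section of it. *)
Definition drop_mx (y : snk Q) :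
    'M[F]_(qdim (inr y : vertex Q), @qdim (decrease_sink j) (inr y)) :=
  shift_mx 0 (y == j) _ _.

Definition lift_mx (y : snk Q) :
    'M[F]_(@qdim (decrease_sink j) (inr y), qdim (inr y : vertex Q)) :=
  shift_mx (y == j) 0 _ _.

Lemma lift_mxK y : lift_mx y *m drop_mx y = 1%:M.
Proof.
rewrite shift_mx_mul; first by rewrite addn0 add0n shift_mx_id.
case=> k /=; rewrite (_ : inr y == inr j = (y == j)) //.
by case: eqP => _ /=; lia.
Qed.

Definition decrease_rep (X : rep F Q) : rep F (decrease_sink j) :=
  fun i y (a : 'I_(narr i y)) => X i y a *m drop_mx y.

Definition lift_rep (Y : rep F (decrease_sink j)) : rep F Q :=
  fun i y (a : 'I_(narr i y)) => Y i y a *m lift_mx y.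

End Decrease.
Arguments decrease_rep {F Q} j X.

Lemma eq_subrep (F : fieldType) (Q : bquiver) (X Y : rep F Q) U :
  (forall i j a, X i j a = Y i j a) -> subrep X U -> subrep Y U.
Proof. by move=> XY XU i j a; rewrite -XY. Qed.

(* Both conditions hold for generic t on the affine line joining A (t = 0) to
   X (t = 1). *)
Lemma semistable_image_generic (R : realType) (Q : bquiver) (j : snk Q)
    (c : rat) :
  semistable R[i] (decrease_sink j) ->
  (exists X : rep R[i] Q,
     forall U : src_subspaces R[i] Q, (exists i, U i != 0) ->
     c * (src_dim U)%:R < (image_dim X U)%:R) ->
  exists X : rep R[i] Q, semistable_rep (decrease_rep j X) /\
    forall U : subspaces R[i] Q, subrep X U -> (exists i, U (inl i) != 0) ->
      c * (\sum_(i : src Q) \rank (U (inl i)))%N%:R <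
      (\sum_(y : snk Q) \rank (U (inr y)))%N%:R.
Proof.
move=> [Y Yss] [X XP].
pose A := lift_rep Y; pose Z : rep R[i] Q := fun i y a => X i y a - A i y a.
pose N : rep R[i] Q := fun i y a => A i y a - X i y a.
have [|h1 h1n0 h1P] := @subrep_generic R _ Y (decrease_rep j Z) (fun r =>
    (exists q, r q != 0%N) -> slope r <= slope (@qdim (decrease_sink j))).
  by move=> U YU [q Uq]; apply: Yss => //; exists q; rewrite -mxrank_eq0.
(* The image bound becomes a property of dimension vectors of subrepresentations, since the sink
   part of a subrepresentation contains the image of its source part. *)
have [|h2 h2n0 h2P] := @subrep_generic R _ X N (fun r =>
    (exists i, r (inl i) != 0%N) ->
    c * (\sum_(i : src Q) r (inl i))%N%:R < (\sum_(y : snk Q) r (inr y))%N%:R).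
  move=> U XU [i Ui].
  apply: (lt_le_trans (XP (fun i => U (inl i)) _)).
    by exists i; rewrite -mxrank_eq0.
  rewrite ler_nat; apply: leq_sum => y _; apply: mxrankS.
  apply/sumsmx_subP => k _; apply/sumsmx_subP => a _.
  by rewrite genmxE; exact: XU.
(* The parameter of [h2] runs from X to A, so it is 1 - t. *)
have : h1 * (h2 \Po (1 - 'X)) != 0.
  rewrite mulf_neq0 // comp_poly2_eq0 //.
  by rewrite -opprB size_polyN size_XsubC.
case/closed_nonrootP => t.
rewrite rootM negb_or /root horner_comp !hornerE => /andP[t1 t2].
exists (add_rep A Z t); split.
  move=> U XU [q Uq]; apply: (h1P t t1 U); last by exists q; rewrite mxrank_eq0.
  apply: eq_subrep XU => i y a.
  rewrite /decrease_rep /add_rep mulmxDl -scalemxAl -[A i y a *m _]mulmxA.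
  by rewrite lift_mxK mulmx1.
move=> U XU [i Ui]; apply: (h2P _ t2 U); last by exists i; rewrite mxrank_eq0.
apply: eq_subrep XU => k y a; rewrite /add_rep /Z /N.
by rewrite scalerBl scale1r -scalerN opprB addrA subrKC.
Qed.

(** * The glued representation *)

Definition preimage_mx (F : fieldType) p n (E : 'M[F]_(p, n)) (U : 'M[F]_n) :
  'M[F]_p := kermx (E *m cokermx U).

Lemma sub_preimage_mx (F : fieldType) m p n (E : 'M[F]_(p, n)) (U : 'M[F]_n)
    (W : 'M[F]_(m, p)) :
  (W <= preimage_mx E U)%MS = (W *m E <= U)%MS.
Proof. by rewrite sub_kermx submxE mulmxA. Qed.

(** Rank-nullity for G on U: the kernel contains the image under E of the preimage of U, because E G
    = 0, and E preserves its dimension. *)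
Lemma mxrank_preimage (F : fieldType) p n q (E : 'M[F]_(p, n))
    (G : 'M[F]_(n, q)) (U : 'M[F]_n) :
  row_free E -> E *m G = 0 ->
  (\rank (preimage_mx E U) + \rank (U *m G) <= \rank U)%N.
Proof.
move=> fE EG; set W := preimage_mx E U.
rewrite -(mxrank_mul_ker U G) addnC leq_add2l -(mxrankMfree W fE) mxrankS //.
rewrite sub_capmx -sub_preimage_mx submx_refl sub_kermx.
by rewrite -mulmxA EG mulmx0 eqxx.
Qed.

Section Glue.
Variables (T0 T1 : bquiver) (j0 : snk T0) (j1 : snk T1).
Notation dim0 := (qdim (inr j0 : vertex T0)).
Notation dim1 := (qdim (inr j1 : vertex T1)).
Notation Q := (glue j0 j1 (dim0 + dim1 - 1)).
Hypotheses (dim0_gt0 : (0 < dim0)%N) (dim1_gt0 : (0 < dim1)%N).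

Lemma sum_glue_snk (f : snk Q -> nat) :
  (\sum_s f s = \sum_(x : snk T0) f (inl x) + \sum_z f (inr z))%N.
Proof. by rewrite /= big_sumType. Qed.

Lemma sum_glue_src (f : src Q -> nat) :
  (\sum_s f s = \sum_(i : src T0) f (inl i) + \sum_(i : src T1) f (inr i))%N.
Proof. by rewrite /= big_sumType. Qed.

Lemma sum_nonglue (f : snk T1 -> nat) :
  (\sum_(z : {y : snk T1 | y != j1}) f (val z) = \sum_(y | y != j1) f y)%N.
Proof. by rewrite (big_sub (fun y => y != j1)). Qed.

Lemma dim_type_glue a0 b0 a1 b1 :
  dim_type T0 = (a0, b0) -> dim_type T1 = (a1, b1) ->
  dim_type Q = (a0 + a1, b0 + b1 - 1)%N.
Proof.
move=> [<- <-] [<- <-]; rewrite /dim_type sum_glue_src sum_glue_snk.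
congr pair; rewrite [in LHS](bigD1 j0) //= eqxx.
rewrite (sum_nonglue (fun y => qdim (inr y : vertex T1))).
rewrite [in RHS](bigD1 j0) //= [in RHS](bigD1 j1) //=.
under eq_bigr => x /negbTE -> do [].
lia.
Qed.

Section Rep.
Variable F : fieldType.

Definition glue_in0 (x : snk T0) :
    'M[F]_(qdim (inr x : vertex T0), @qdim Q (inr (inl x))) :=
  shift_mx 0 0 _ _.

Definition glue_in1 (x : snk T0) : 'M[F]_(dim1, @qdim Q (inr (inl x))) :=
  shift_mx dim0.-1 0 _ _.

(* At the glueing vertex the images of T0 and T1 are coordinate subspaces
   meeting in the line spanned by the coordinate vector of index dim0.-1.
   The sum over c' has one term, the arrow of T1 with the number of c. *)
Definition glue_rep (X0 : rep F T0) (X1 : rep F T1) : rep F Q :=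
  fun p q => match p, q return
    'I_(@narr Q p q) -> 'M[F]_(@qdim Q (inl p), @qdim Q (inr q)) with
  | inl i, inl x => fun c => X0 i x c *m glue_in0 x
  | inl i, inr y => fun=> 0
  | inr i, inl x => fun c =>
      \sum_(c' : 'I_(narr i j1) | c' == c :> nat) X1 i j1 c' *m glue_in1 x
  | inr i, inr y => fun c => X1 i (val y) c
  end.

Variables (X0 : rep F T0) (X1 : rep F T1) (U : subspaces F Q).
Hypothesis XU : subrep (glue_rep X0 X1) U.

Lemma glue_in0_free x : row_free (glue_in0 x).
Proof. by apply: shift_mx_free; rewrite /=; case: eqP => [->|_]; lia. Qed.

Lemma glue_in1_free : row_free (glue_in1 j0).
Proof. by apply: shift_mx_free; rewrite /= eqxx; lia. Qed.

Lemma subrep_glue0 i x (a : 'I_(narr i x)) :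
  (U (inl (inl i)) *m @X0 i x a *m glue_in0 x <= U (inr (inl x)))%MS.
Proof. by rewrite -mulmxA; exact: (@XU (inl i) (inl x) a). Qed.

Lemma subrep_glue1 i (a : 'I_(narr i j1)) :
  (U (inl (inr i)) *m @X1 i j1 a *m glue_in1 j0 <= U (inr (inl j0)))%MS.
Proof.
have ca : (a < @narr Q (inr i) (inl j0))%N by rewrite /= eqxx.
have := @XU (inr i) (inl j0) (Ordinal ca); rewrite /= (big_pred1 a) ?mulmxA //.
Qed.

Definition glue_sub0 : subspaces F T0 := fun q =>
  match q return 'M_(qdim q) with
  | inl i => U (inl (inl i))
  | inr x => preimage_mx (glue_in0 x) (U (inr (inl x)))
  end.

Lemma subrep_glue_sub0 : subrep X0 glue_sub0.
Proof. by move=> i x a; rewrite sub_preimage_mx; exact: subrep_glue0. Qed.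

Notation T1' := (decrease_sink j1).

(** The block from sink [s] to sink [y] of the quotient map X -> X1', zero between sinks that do not
    correspond. At the glueing vertex it kills the first [dim0] coordinates, those of T0. *)
Definition glue_out (s : snk Q) (y : snk T1) :
    'M[F]_(@qdim Q (inr s), @qdim T1' (inr y)) :=
  match s with
  | inl x => if (x == j0) && (y == j1) then shift_mx 0 dim0 _ _ else 0
  | inr z => if val z == y then shift_mx 0 0 _ _ else 0
  end.

Lemma glue_out_inl : glue_out (inl j0) j1 = shift_mx 0 dim0 _ _.
Proof. by rewrite /glue_out !eqxx. Qed.

Lemma glue_out_inl_eq0 x y : ~~ ((x == j0) && (y == j1)) ->
  glue_out (inl x) y = 0.
Proof. by rewrite /glue_out => /negbTE ->. Qed.

Lemma glue_out_inr z : glue_out (inr z) (val z) = shift_mx 0 0 _ _.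
Proof. by rewrite /glue_out eqxx. Qed.

Lemma glue_out_inr_eq0 z y : y != val z -> glue_out (inr z) y = 0.
Proof. by rewrite /glue_out eq_sym => /negbTE ->. Qed.

Lemma glue_in_out x : glue_in0 x *m glue_out (inl x) j1 = 0.
Proof.
have [xj|xj] : x = j0 \/ x != j0 by case: (x =P j0) => ?; [left|right].
  subst x; rewrite glue_out_inl shift_mx_mul ?shift_mx_eq0 //; first by lia.
  by move=> [k] /=; rewrite eqxx; lia.
by rewrite glue_out_inl_eq0 ?mulmx0 // (negbTE xj).
Qed.

Definition glue_sub1 : subspaces F T1' := fun q =>
  match q return 'M_(@qdim T1' q) with
  | inl i => U (inl (inr i))
  | inr y => (\sum_(s : snk Q) <<U (inr s) *m glue_out s y>>)%MS
  end.

Lemma subrep_glue_sub1 : subrep (decrease_rep j1 X1) glue_sub1.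
Proof.
move=> i y a; rewrite /decrease_rep /=.
have [yj|yj] := eqVneq y j1.
  subst y; rewrite (sumsmx_sup (inl j0)) // genmxE glue_out_inl.
  (* Entering with offset [dim0.-1] and then killing [dim0] coordinates kills exactly the first
     coordinate of X1, the line shared with X0. *)
  have -> : drop_mx F j1 j1 = glue_in1 j0 *m shift_mx 0 dim0 _ _.
    rewrite shift_mx_mul; last by move=> [k] /=; rewrite eqxx; lia.
    have -> : (0 + dim0 = dim0.-1 + (j1 == j1))%N by rewrite eqxx; lia.
    by rewrite shift_mx_cancel.
  by rewrite !mulmxA submxMr // subrep_glue1.
rewrite (sumsmx_sup (inr (Sub y yj))) // genmxE (glue_out_inr (Sub y yj)).
rewrite /drop_mx (negbTE yj) mulmxA submxMr //.
exact: (@XU (inr i) (inr (Sub y yj)) a).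
Qed.

(** At a sink of T0, the glueing vertex included, [mxrank_preimage] applies; at the other sinks of
    T1 only the diagonal block of the quotient map is nonzero. *)
Lemma rank_glue_sub :
  (\sum_(x : snk T0) \rank (glue_sub0 (inr x)) +
   \sum_(y : snk T1) \rank (glue_sub1 (inr y)) <=
   \sum_(s : snk Q) \rank (U (inr s)))%N.
Proof.
pose f s := (\sum_(y : snk T1) \rank (U (inr s) *m glue_out s y))%N.
have sub1 : (\sum_(y : snk T1) \rank (glue_sub1 (inr y)) <=
    \sum_(s : snk Q) f s)%N.
  rewrite /f exchange_big /=; apply: leq_sum => y _.
  apply: leq_trans (mxrank_sum_leqif _).1 _ => /=.
  by apply: leq_sum => s _; rewrite genmxE.
apply: leq_trans (leq_add (leqnn _) sub1) _.
rewrite !sum_glue_snk addnA -big_split /=; apply: leq_add; last first.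
  apply: leq_sum => z _; rewrite /f (bigD1 (val z)) // big1 => [|y yz].
    by rewrite [leqLHS]addn0 mxrankM_maxl.
  by rewrite glue_out_inr_eq0 // mulmx0 mxrank0.
apply: leq_sum => x _; rewrite /f (bigD1 j1) // big1 => [|y yj]; last first.
  by rewrite glue_out_inl_eq0 ?mulmx0 ?mxrank0 // (negbTE yj) andbF.
rewrite -[X in (_ + X)%N]/(addn _ _) addn0.
by apply: mxrank_preimage; [exact: glue_in0_free|exact: glue_in_out].
Qed.

(** The subrepresentation of X1 generated by the sources of U in T1, to which condition (iii) will
    be applied. *)
Definition glue_gen1 : subspaces F T1 := fun q =>
  match q return 'M_(qdim q) with
  | inl i => U (inl (inr i))
  | inr y => (\sum_(i : src T1) \sum_(a < narr i y)
                <<U (inl (inr i)) *m X1 a>>)%MS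
  end.

Lemma subrep_glue_gen1 : subrep X1 glue_gen1.
Proof.
move=> i y a /=; rewrite (sumsmx_sup i) // (sumsmx_sup a) // genmxE.
exact: submx_refl.
Qed.

(** The generated subspaces lie in U; at the glueing vertex this is after the embedding [glue_in1],
    whose injectivity keeps the dimension. *)
Lemma rank_glue_gen1 :
  (\sum_(y : snk T1) \rank (glue_gen1 (inr y)) <=
   \sum_(s : snk Q) \rank (U (inr s)))%N.
Proof.
rewrite sum_glue_snk (bigD1 j1) // -sum_nonglue; apply: leq_add.
  rewrite (bigD1 j0) //=; apply: leq_trans (leq_addr _ _).
  rewrite -(mxrankMfree _ glue_in1_free) mxrankS // /glue_gen1 sumsmxMr_gen.
  apply/sumsmx_subP => i _; rewrite genmxE sumsmxMr_gen.
  apply/sumsmx_subP => a _.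
  by rewrite genmxE (eqmxMr _ (genmxE _)) subrep_glue1.
apply: leq_sum => z _; rewrite mxrankS //=.
apply/sumsmx_subP => i _; apply/sumsmx_subP => a _; rewrite genmxE.
exact: (@XU (inr i) (inr z) a).
Qed.

End Rep.
End Glue.

(** * Slopes and adjacency *)

Section Slope.
Variables (Q : bquiver) (f g : vertex Q -> nat).
Notation srcs f := (\sum_(i : src Q) f (inl i))%N.
Notation snks f := (\sum_(j : snk Q) f (inr j))%N.

Lemma slopeE (h : vertex Q -> nat) :
  slope h = (srcs h)%:R / (srcs h + snks h)%:R.
Proof. by rewrite /slope big_sumType. Qed.

Hypotheses (f_gt0 : exists q, f q != 0%N) (g_gt0 : exists q, g q != 0%N).

Lemma total_gt0 (h : vertex Q -> nat) : (exists q, h q != 0%N) ->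
  (0 < srcs h + snks h)%N.
Proof.
case=> q; rewrite -lt0n => hq.
have <- : (\sum_q h q)%N = (srcs h + snks h)%N by rewrite big_sumType.
by rewrite (bigD1 q) //= ltn_addr.
Qed.

Lemma slope_lt : (slope f < slope g) = (srcs f * snks g < srcs g * snks f)%N.
Proof.
rewrite !slopeE ltr_pdivrMr ?ltr0n ?total_gt0 // mulrAC.
rewrite ltr_pdivlMr ?ltr0n ?total_gt0 // -!natrM ltr_nat; lia.
Qed.

Lemma slope_le : (slope f <= slope g) = (srcs f * snks g <= srcs g * snks f)%N.
Proof.
rewrite !slopeE ler_pdivrMr ?ltr0n ?total_gt0 // mulrAC.
rewrite ler_pdivlMr ?ltr0n ?total_gt0 // -!natrM ler_nat; lia.
Qed.

End Slope.

(** * Neighbours in the glueing quiver *)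

Section Adjacency.
Variables (T0 T1 : bquiver) (j0 : snk T0) (j1 : snk T1) (n m : nat).
Notation Q := (glue j0 j1 n).
Hypotheses (dim0_gt0 : (0 < qdim (inr j0 : vertex T0))%N).
Hypotheses (dim1_gt0 : (0 < qdim (inr j1 : vertex T1))%N).

Definition glue_vertex0 (q : vertex T0) : vertex Q :=
  match q with inl i => inl (inl i) | inr x => inr (inl x) end.

Definition glue_vertex1 (q : vertex T1) : vertex Q :=
  match q with
  | inl i => inl (inr i)
  | inr y => if insub y is Some z then inr (inr z) else inr (inl j0)
  end.

Lemma glue_vertex1_val (z : {y : snk T1 | y != j1}) :
  glue_vertex1 (inr (val z)) = inr (inr z).
Proof. by rewrite /glue_vertex1 valK. Qed.

Lemma glue_vertex1_glue : glue_vertex1 (inr j1) = inr (inl j0).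
Proof. by rewrite /glue_vertex1 insubF // eqxx. Qed.

Definition neighbours (T : bquiver) (q : vertex T) : {set vertex T} :=
  [set p | Defs.adjacent q p & (0 < qdim p)%N].

(** If the glueing vertex is a neighbour of [i], then [j0] already counts as one in T0, because its
    dimension there is positive. *)
Lemma neighbours_inl (i : src T0) :
  neighbours (inl (inl i) : vertex Q) \subset
  glue_vertex0 @: neighbours (inl i : vertex T0).
Proof.
apply/fintype.subsetP => -[p|[x|z]]; rewrite !inE //= => /andP[ax dx].
apply/imsetP; exists (inr x) => //; rewrite inE /= ax /=.
by case: eqP dx => [->|].
Qed.

Lemma neighbours_inr (i : src T1) :
  neighbours (inl (inr i) : vertex Q) \subset
  glue_vertex1 @: neighbours (inl i : vertex T1).
Proof.
apply/fintype.subsetP => -[p|[x|z]]; rewrite !inE //= => /andP[ax dx].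
  apply/imsetP; exists (inr j1).
    by rewrite inE /= dim1_gt0 andbT; move: ax; case: eqP.
  by move: ax; case: eqP => // -> _; rewrite glue_vertex1_glue.
apply/imsetP; exists (inr (val z)); last by rewrite glue_vertex1_val.
by rewrite inE /= ax.
Qed.

Lemma neighbours_snk0 (x : snk T0) : x != j0 ->
  neighbours (inr (inl x) : vertex Q) \subset
  glue_vertex0 @: neighbours (inr x : vertex T0).
Proof.
move=> /negbTE xj.
apply/fintype.subsetP => -[[i|i]|p]; rewrite !inE //= => /andP[ax dx].
  by apply/imsetP; exists (inl i) => //; rewrite inE /= ax.
by rewrite xj in ax.
Qed.

Lemma neighbours_snk1 (z : {y : snk T1 | y != j1}) :
  neighbours (inr (inr z) : vertex Q) \subset
  glue_vertex1 @: neighbours (inr (val z) : vertex T1).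
Proof.
apply/fintype.subsetP => -[[i|i]|p]; rewrite !inE //= => /andP[ax dx].
by apply/imsetP; exists (inl i) => //; rewrite inE /= ax.
Qed.

Lemma neighbours_glue :
  neighbours (inr (inl j0) : vertex Q) \subset
  glue_vertex0 @: neighbours (inr j0 : vertex T0) :|:
  glue_vertex1 @: neighbours (inr j1 : vertex T1).
Proof.
apply/fintype.subsetP => -[[i|i]|p]; rewrite !inE //= => /andP[ax dx];
  apply/orP; [left|right]; apply/imsetP; exists (inl i) => //.
  by rewrite inE /= ax.
by rewrite eqxx in ax; rewrite inE /= ax.
Qed.

(** Only at the glueing vertex do the neighbours come from both quivers, whence the bound on the
    sum. *)
Lemma mbipartite_glue : mbipartite m T0 -> mbipartite m T1 ->
  (nb_adj (inr j0 : vertex T0) + nb_adj (inr j1 : vertex T1) <= m)%N ->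
  mbipartite m Q.
Proof.
have le_m (T : bquiver) (f : vertex T -> vertex Q) (p : vertex Q) q :
    mbipartite m T -> neighbours p \subset f @: neighbours q ->
    (nb_adj p <= m)%N.
  move=> mT /subset_leq_card /leq_trans; apply.
  exact: leq_trans (leq_imset_card _ _) (mT q).
move=> m0 m1 mj; case=> [[i|i]|[x|z]].
- exact: le_m m0 (neighbours_inl i).
- exact: le_m m1 (neighbours_inr i).
- have [-> {x}|xj] := eqVneq x j0; last exact: le_m m0 (neighbours_snk0 xj).
  apply: leq_trans (subset_leq_card neighbours_glue) _.
  apply: leq_trans (leq_card_setU _ _) _.
  by apply: leq_trans mj; apply: leq_add; exact: leq_imset_card.
- exact: le_m m1 (neighbours_snk1 z).
Qed.

End Adjacency.

Lemma dim_type_decrease (Q : bquiver) (j : snk Q) a b :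
  (0 < qdim (inr j : vertex Q))%N -> dim_type Q = (a, (b + 1)%N) ->
  dim_type (decrease_sink j) = (a, b).
Proof.
move=> j_gt0 [<- sb]; congr pair; move: sb.
rewrite [in X in X -> _](bigD1 j) //= [in X in _ -> X](bigD1 j) //= eqxx.
under [in X in _ -> X]eq_bigr => y /negbTE yj.
  rewrite (_ : inr y == inr j = (y == j)) // yj; over.
by move=> /=; lia.
Qed.

(** * Rank inequalities from stability and semistability *)

Section Slopes.
Variables (F : fieldType) (Q : bquiver) (X : rep F Q) (a b : nat).
Hypothesis dimQ : dim_type Q = (a, b).
Variable U : subspaces F Q.
Notation rk_src := (\sum_(i : src Q) \rank (U (inl i)))%N.
Notation rk_snk := (\sum_(j : snk Q) \rank (U (inr j)))%N.

Lemma sum_rank_leq_src : (rk_src <= a)%N.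
Proof. by case: dimQ => <- _; apply: leq_sum => i _; exact: rank_leq_row. Qed.

Lemma sum_rank_lt : (exists q, ~~ row_full (U q)) ->
  (rk_src + rk_snk < a + b)%N.
Proof.
case=> q Uq; case: dimQ => <- <-.
have /= <- := big_sumType addn xpredT (fun q : vertex Q => \rank (U q)).
have /= <- := big_sumType addn xpredT (@qdim Q).
rewrite (bigD1 q) //= [X in (_ < X)%N](bigD1 q) //= -addSn leq_add //.
  by rewrite ltn_neqAle Uq rank_leq_row.
by apply: leq_sum => i _; exact: rank_leq_row.
Qed.

Lemma neq0_total : (exists q, U q != 0) -> (exists q : vertex Q, qdim q != 0%N).
Proof.
case=> q Uq; exists q; rewrite -lt0n (leq_trans _ (rank_leq_row (U q))) //.
by rewrite lt0n mxrank_eq0.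
Qed.

Lemma stable_rank_lt : stable_rep X -> subrep X U ->
  (exists q, U q != 0) -> (exists q, ~~ row_full (U q)) ->
  (rk_src * b < a * rk_snk)%N.
Proof.
move=> Xs XU U0 Uf; have := Xs U XU U0 Uf; rewrite slope_lt.
- by case: dimQ => <- <-.
- by case: U0 => q Uq; exists q; rewrite mxrank_eq0.
- exact: neq0_total.
Qed.

Lemma semistable_rank_le : semistable_rep X -> subrep X U ->
  (rk_src * b <= a * rk_snk)%N.
Proof.
move=> Xs XU; have [/existsP U0|U0] := boolP [exists q, U q != 0].
  have := Xs U XU U0; rewrite slope_le.
  - by case: dimQ => <- <-.
  - by case: U0 => q Uq; exists q; rewrite mxrank_eq0.
  - exact: neq0_total.
rewrite big1 // => i _; apply/eqP; rewrite mxrank_eq0.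
by move/existsPn/(_ (inl i)): U0; rewrite negbK.
Qed.

(** The cases U = 0 and U = X, which stability leaves out, give equality. *)
Lemma stable_rank_le : stable_rep X -> subrep X U ->
  (rk_src * b <= a * rk_snk)%N.
Proof.
move=> Xs XU; have [/existsP U0|U0] := boolP [exists q, U q != 0]; last first.
  rewrite big1 // => i _; apply/eqP; rewrite mxrank_eq0.
  by move/existsPn/(_ (inl i)): U0; rewrite negbK.
have [/existsP Uf|Uf] := boolP [exists q, ~~ row_full (U q)].
  exact/ltnW/stable_rank_lt.
have Ur q : \rank (U q) = qdim q.
  by move/existsPn/(_ q): Uf; rewrite negbK => /eqP.
case: dimQ => <- <-; under eq_bigr do rewrite Ur.
by under [X in (_ <= _ * X)%N]eq_bigr do rewrite Ur.
Qed.

End Slopes.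

Theorem theorem2p17 (R : realType) (m d e ds es k l : nat)
  (T0 T1 : bquiver) (j0 : snk T0) (j1 : snk T1) :
  (3 <= m)%N -> (0 < d)%N -> (d <= e)%N -> coprime d e ->
  starting_vector d e ds es ->
  (1 <= l)%N ->
  in_T R[i] m (ds + k * d) (es + k * e) T0 ->
  in_S R[i] m d e ds es k l j1 ->
  (0 < qdim (inr j0 : vertex T0))%N ->
  (nb_adj (inr j0 : vertex T0) + nb_adj (inr j1 : vertex T1) <= m)%N ->
  in_T R[i] m (ds + (k + l) * d) (es + (k + l) * e)
    (glue j0 j1
      (qdim (inr j0 : vertex T0) + qdim (inr j1 : vertex T1) - 1)%N).
Proof.
move=> _ d_gt0 _ _ [_ _ det1 _] l_gt0 [m0 dim0 [X0 X0s]].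
move=> [m1 dim1 j1_gt0 _ _ ss img] j0_gt0 mj.
have {}det1 : (es * d = e * ds + 1)%N by lia.
have [X1 [X1ss X1P]] := semistable_image_generic ss img.
have dimQ := dim_type_glue j0_gt0 j1_gt0 dim0 dim1.
split; first exact: mbipartite_glue.
  by rewrite dimQ; congr pair; nia.
have {}dimQ : dim_type (glue j0 j1 (qdim (inr j0 : vertex T0) +
   qdim (inr j1 : vertex T1) - 1)%N) = (ds + (k + l) * d, es + (k + l) * e)%N.
  by rewrite dimQ; congr pair; nia.
set D := (ds + _)%N in dimQ *; set E := (es + _)%N in dimQ *.
(* Adding multiples of (d, e) to (ds, es) does not change the determinant with (d, e). *)
have DE : (E * d = e * D + 1)%N by rewrite /D /E; nia.
have D_gt0 : (0 < D)%N by rewrite /D; nia.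
exists (glue_rep X0 X1) => U XU U_neq0 U_full.
rewrite slope_lt; last 2 first.
- by case: U_neq0 => q Uq; exists q; rewrite mxrank_eq0.
- exact: neq0_total U_neq0.
have lt_tot := sum_rank_lt dimQ U_full.
have le_src := sum_rank_leq_src dimQ U.
case: (dimQ) => -> ->.
move: lt_tot le_src; rewrite sum_glue_src.
set d0 := (\sum_(i : src T0) _)%N; set d1 := (\sum_(i : src T1) _)%N.
set e' := (\sum_(s : snk _) _)%N => lt_tot le_src.
have [U0|/existsP[i Ui]] := boolP [forall i : src T0, U (inl (inl i)) == 0].
  have d00 : d0 = 0%N.
    by apply: big1 => i _; apply/eqP; rewrite mxrank_eq0 (forallP U0).
  have [U1|/existsP[i Ui]] := boolP [forall i : src T1, U (inl (inr i)) == 0].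
    have d10 : d1 = 0%N.
      by apply: big1 => i _; apply/eqP; rewrite mxrank_eq0 (forallP U1).
    rewrite d00 d10 muln_gt0 D_gt0 /=.
    case: U_neq0 => -[[i|i]|s] Uq.
    - by rewrite (eqP (forallP U0 i)) eqxx in Uq.
    - by rewrite (eqP (forallP U1 i)) eqxx in Uq.
    - by rewrite /e' (bigD1 s) //= ltn_addr // lt0n mxrank_eq0.
  (* The sources of U lie in T1 only. The ratio in condition (iii) is E / D, and the generated
     subrepresentation has sink dimension at most e'. *)
  have := X1P _ (subrep_glue_gen1 X1 U).
  have -> : ((k + l) * e + es = E)%N by rewrite /E addnC.
  have -> : ((k + l) * d + ds = D)%N by rewrite /D addnC.
  move=> /(_ (ex_intro _ i Ui)) /=.
  rewrite mulrAC ltr_pdivrMr ?ltr0n // -!natrM ltr_nat d00 add0n.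
  have := rank_glue_gen1 j0_gt0 j1_gt0 XU; rewrite -/e' -/d1.
  move: (\sum_(y : snk T1) _)%N => e1 le1; nia.
have d0_gt0 : (0 < d0)%N.
  by rewrite /d0 (bigD1 i) //= ltn_addr // lt0n mxrank_eq0.
have := stable_rank_le dim0 X0s (subrep_glue_sub0 XU).
have := semistable_rank_le (dim_type_decrease j1_gt0 dim1) X1ss
  (subrep_glue_sub1 j0_gt0 j1_gt0 XU).
have := rank_glue_sub j0_gt0 j1_gt0 U.
rewrite -/e' /= -/d0 -/d1.
move: (\sum_(x : snk T0) _)%N (\sum_(y : snk T1) _)%N => e0 e1 le_e le1 le0.
(* X1' has dimension type (l d, l e); the factor l cancels. *)
have {}le1 : (d1 * e <= d * e1)%N.
  by rewrite -(leq_pmul2l l_gt0); nia.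
(* With (D0, E0) the dimension type of T0, E0 d = e D0 + 1 and d0 E0 <= D0 e0 give D0 (d e0 - e d0)
   >= d0 > 0. *)
have {}le0 : (e * d0 < d * e0)%N.
  have D0E0 : ((es + k * e) * d = e * (ds + k * d) + 1)%N by nia.
  move: le0 D0E0; move: (ds + k * d)%N (es + k * e)%N => D0 E0; nia.
have gap : (e * (d0 + d1) + 1 <= d * e')%N by nia.
have [lt_src|ge_src] := ltnP (d0 + d1) D.
  (* With s = d0 + d1 < D: d E s = (e D + 1) s < D (e s + 1) <= d D e'. *)
  rewrite -(ltn_pmul2l d_gt0); nia.
(* Here d0 + d1 = D, so [gap] gives d e' >= e D + 1 = d E, while [lt_tot] forces e' < E: a
   contradiction. *)
nia.
Qed.
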